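(* Let $m$, $n$ and $q$ be positive integers. Then \[ \sum_{k = 1}^\infty (-1)^{nk-1}\,\frac{\prod_{j=1}^{m-1} L_{nk+jnq}}{\prod_{j=0}^{m} F_{nk+jnq}} = \frac{q\sqrt{5^m}}{2F_{mnq}} - \frac{1}{2F_{mnq}}\sum_{k=1}^{q}\prod_{j=0}^{m-1}\frac{L_{nk+jnq}}{F_{nk+jnq}}, \] so that, if $n$ is even, \[ \sum_{k = 1}^\infty \frac{\prod_{j=1}^{m-1} L_{nk+jnq}}{\prod_{j=0}^{m} F_{nk+jnq}} = \frac{1}{2F_{mnq}}\sum_{k=1}^{q}\prod_{j=0}^{m-1}\frac{L_{nk+jnq}}{F_{nk+jnq}} - \frac{q\sqrt{5^m}}{2F_{mnq}}, \] and, if $n$ is odd, \[ \sum_{k = 1}^\infty (-1)^{k-1}\,\frac{\prod_{j=1}^{m-1} L_{nk+jnq}}{\prod_{j=0}^{m} F_{nk+jnq}} = \frac{q\sqrt{5^m}}{2F_{mnq}} - \frac{1}{2F_{mnq}}\sum_{k=1}^{q}\prod_{j=0}^{m-1}\frac{L_{nk+jnq}}{F_{nk+jnq}}. \]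
   Context: The Fibonacci numbers are defined by $F_0=0$, $F_1=1$, $F_n=F_{n-1}+F_{n-2}$, and the Lucas numbers by $L_0=2$, $L_1=1$, $L_n=L_{n-1}+L_{n-2}$. Infinite sums are limits of partial sums. Empty products equal $1$ (in particular $\prod_{j=1}^{0}=1$). *)

(* Defs.v *)
From mathcomp Require Import all_boot.

Set Implicit Arguments.
Unset Strict Implicit.
Unset Printing Implicit Defensive.

Fixpoint fib (n : nat) : nat :=
  match n with
  | 0 => 0
  | n'.+1 => match n' with
             | 0 => 1
             | n''.+1 => fib n' + fib n''
             end
  end.

Fixpoint lucas (n : nat) : nat :=
  match n with
  | 0 => 2
  | n'.+1 => match n' with
             | 0 => 1
             | n''.+1 => lucas n' + lucas n''
             end
  end.

(* Main.v *)
Require Import Defs.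
From mathcomp Require Import all_boot all_order all_algebra.
From mathcomp Require Import all_classical all_reals all_analysis.
From mathcomp Require Import ring lra zify.
Import Order.TTheory GRing.Theory Num.Theory.
Import numFieldNormedType.Exports.
Local Open Scope classical_set_scope.
Local Open Scope ring_scope.

(** Put [P k := \prod_(0 <= j < m) L_(nk+jnq) / F_(nk+jnq)]. The factors of [P k]
    and [P (k + q)] agree except at the two ends, so d'Ocagne's identity
    [L_a F_(a+b) - F_a L_(a+b) = 2 (-1)^a F_b] with [a = nk], [b = mnq] identifies
    [P k - P (k + q)] with [2 (-1)^(nk) F_(mnq)] times the k-th summand. The series
    therefore telescopes with step [q]; since [L_i / F_i] tends to [sqrt 5], the
    boundary terms [P (N + 1), ..., P (N + q)] each tend to [sqrt 5 ^ m]. *)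

Lemma fibSS i : fib i.+2 = (fib i.+1 + fib i)%N.
Proof. by []. Qed.

Lemma lucasSS i : lucas i.+2 = (lucas i.+1 + lucas i)%N.
Proof. by []. Qed.

Lemma fib_gt0 i : (0 < fib i.+1)%N.
Proof. by elim: i => // i IH; rewrite fibSS ltn_addr. Qed.

(** A crude linear lower bound; it is enough to dominate the error of [lucas_fib_ratio] by a
    multiple of the harmonic sequence. *)
Lemma leq_fibSS i : (i < fib i.+2)%N.
Proof.
elim: i => // i IH; rewrite fibSS.
by have := fib_gt0 i; lia.
Qed.

Lemma fib_lucas i : (lucas i + fib i = 2 * fib i.+1)%N.
Proof.
suff : (lucas i + fib i = 2 * fib i.+1 /\ lucas i.+1 + fib i.+1 = 2 * fib i.+2)%N.
  by case.
elim: i => // i [IH1 IH2]; split=> //.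
rewrite lucasSS [fib i.+3]fibSS; move: IH1 IH2; rewrite !fibSS; lia.
Qed.

(** For fixed [a] both sides obey the Fibonacci recurrence in [b], so the cases [b = 0] (both sides
    vanish) and [b = 1] suffice. The latter is [base], an induction in which each step flips the
    sign. *)
Lemma lucasM_fibD (R : comPzRingType) (a b : nat) :
  (lucas a)%:R * (fib (a + b))%:R - (fib a)%:R * (lucas (a + b))%:R
    = 2 * (-1) ^+ a * (fib b)%:R :> R.
Proof.
have base c : (lucas c)%:R * (fib c.+1)%:R - (fib c)%:R * (lucas c.+1)%:R
    = 2 * (-1) ^+ c :> R.
  elim: c => [|c IH]; first by rewrite /=; ring.
  rewrite fibSS lucasSS !natrD exprS.
  by rewrite mulN1r mulrN -IH; ring.
suff : (lucas a)%:R * (fib (a + b))%:R - (fib a)%:R * (lucas (a + b))%:R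
    = 2 * (-1) ^+ a * (fib b)%:R :> R /\
  (lucas a)%:R * (fib (a + b.+1))%:R - (fib a)%:R * (lucas (a + b.+1))%:R
    = 2 * (-1) ^+ a * (fib b.+1)%:R :> R by case.
elim: b => [|b [IH1 IH2]].
  by rewrite addn0 addn1 base /=; split; ring.
split=> //; move: IH2; rewrite !addnS !fibSS lucasSS !natrD => IH2.
by rewrite [RHS]mulrDr -IH1 -IH2; ring.
Qed.

(** This is twice the case [b = 1] of [lucasM_fibD], once every Lucas number is rewritten through
    [fib_lucas]. *)
Lemma lucas_sqr (R : comPzRingType) (i : nat) :
  (lucas i)%:R ^+ 2 - 5 * (fib i)%:R ^+ 2 = 4 * (-1) ^+ i :> R.
Proof.
have L j : (lucas j)%:R = 2 * (fib j.+1)%:R - (fib j)%:R :> R.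
  by rewrite -natrM -fib_lucas natrD addrK.
have := lucasM_fibD R i 1; rewrite addn1 !L fibSS natrD /= => E.
have -> : 4 * (-1) ^+ i = 2 * (2 * (-1) ^+ i * 1) :> R by ring.
by rewrite -E; ring.
Qed.

Lemma sqrtrX (R : rcfType) (x : R) (i : nat) :
  0 <= x -> Num.sqrt (x ^+ i) = Num.sqrt x ^+ i.
Proof.
move=> x0; elim: i => [|i IH]; first by rewrite !expr0 sqrtr1.
by rewrite !exprS sqrtrM// IH.
Qed.

Definition lucas_fib_ratio (R : realType) (i : nat) : R :=
  (lucas i)%:R / (fib i)%:R.

(** Dividing [lucas_sqr] by the square of the Fibonacci number [F] gives
    [|r - s| * (r + s) * F ^ 2 = 4]. As [s] and [F] are at least 1, one factor [F] is absorbed by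
    [(r + s) * F >= 1]; the other supplies the decay. *)
Lemma lucas_fib_ratio_dist (R : realType) (i : nat) :
  `|lucas_fib_ratio R i.+2 - Num.sqrt 5| <= 4 / i.+1%:R.
Proof.
set s := Num.sqrt 5; set r := lucas_fib_ratio R i.+2.
have s2 : s ^+ 2 = 5 by rewrite sqr_sqrtr.
have s0 : 0 <= s by exact: sqrtr_ge0.
have s1 : 1 <= s by nra.
have f0 : 0 < (fib i.+2)%:R :> R by rewrite ltr0n fib_gt0.
have f1 : 1 <= (fib i.+2)%:R :> R by rewrite ler1n fib_gt0.
have fi : i.+1%:R <= (fib i.+2)%:R :> R by rewrite ler_nat leq_fibSS.
have r0 : 0 <= r by rewrite divr_ge0.
have E : (r - s) * (r + s) * (fib i.+2)%:R ^+ 2 = 4 * (-1) ^+ i.+2.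
  rewrite -lucas_sqr -[5]s2 /r /lucas_fib_ratio; field; exact: lt0r_neq0.
have dE : `|r - s| * ((r + s) * (fib i.+2)%:R ^+ 2) = 4.
  have w0 : 0 <= (r + s) * (fib i.+2)%:R ^+ 2 by rewrite mulr_ge0 ?addr_ge0 ?sqr_ge0.
  by rewrite -[X in _ * X](ger0_norm w0) -normrM mulrA E mulrC -signr_odd normrMsign normr_nat.
have := normr_ge0 (r - s); move: dE; set d := `|r - s| => dE d0.
have rs1 : 1 <= (r + s) * (fib i.+2)%:R by nra.
have step : d * (fib i.+2)%:R <= 4.
  rewrite -dE; have -> : d * ((r + s) * (fib i.+2)%:R ^+ 2)
    = d * (fib i.+2)%:R * ((r + s) * (fib i.+2)%:R) by ring.
  by rewrite ler_peMr// mulr_ge0// ltW.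
rewrite ler_pdivlMr ?ltr0Sn//; apply: le_trans step.
by rewrite ler_wpM2l.
Qed.

Lemma cvg_lucas_fib_ratio (R : realType) :
  lucas_fib_ratio R i @[i --> \oo] --> (Num.sqrt 5 : R).
Proof.
(* The shift matches the bound and skips index 0, where the ratio is a division by zero. *)
rewrite -(cvg_shiftn 2); apply/subr_cvg0/norm_cvg0P.
have h0 : (4 * harmonic i : R) @[i --> \oo] --> (0 : R).
  by rewrite -[X in _ --> X](mulr0 4); apply: cvgMr; exact: cvg_harmonic.
apply: (squeeze_cvgr _ (cvg_cst 0) h0); near=> i.
by rewrite normr_ge0/= addn2 lucas_fib_ratio_dist.
Unshelve. all: by end_near. Qed.

Lemma cvgn_affine (a b : nat) : (0 < a)%N -> (a * k + b)%N @[k --> \oo] --> \oo.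
Proof.
move=> a0; apply/cvgnyPge => A; near=> k.
have : (A <= k)%N by near: k; exact: nbhs_infty_ge.
by nia.
Unshelve. all: by end_near. Qed.

(** Induction on [N] slides a window of [q] boundary terms, so [N] and [q] need not be compared. *)
Lemma sum_telescope_step (V : zmodType) (u : nat -> V) (q N : nat) :
  \sum_(1 <= k < N.+1) (u k - u (k + q)%N)
    = \sum_(1 <= k < q.+1) u k - \sum_(0 <= i < q) u (N + i.+1)%N.
Proof.
elim: N => [|N IH].
  by rewrite big_geq // big_add1 /= subrr.
(* Both sides sum [u] over the indices from [N + 1] to [N + q + 1], with the last or the first term
   split off. *)
have H : \sum_(0 <= i < q) u (N + i.+1)%N + u (N + q.+1)%N
    = u N.+1 + \sum_(0 <= i < q) u (N.+1 + i.+1)%N.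
  rewrite -(big_nat_recr q 0 (fun i => u (N + i.+1)%N))// big_nat_recl// addn1.
  by under eq_bigr do rewrite -addSnnS.
by rewrite big_nat_recr//= IH -addrA; congr (_ + _); rewrite addrCA -opprD addSnnS H opprD addNKr.
Qed.

Lemma cvg_sum_telescope_step (R : realType) (u : nat -> R) (l : R) (q : nat) :
  u k @[k --> \oo] --> l ->
  \sum_(1 <= k < N.+1) (u k - u (k + q)%N) @[N --> \oo]
    --> \sum_(1 <= k < q.+1) u k - q%:R * l.
Proof.
move=> ul; under eq_cvg do rewrite sum_telescope_step.
apply: cvgB; first exact: cvg_cst.
have -> : q%:R * l = \sum_(0 <= i < q) l by rewrite big_const_nat subn0 iter_addr_0 mulr_natl.
apply: (cvg_big (op := +%R)); first exact: add_continuous.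
move=> i _; rewrite -(cvg_shiftn i.+1) in ul; exact: ul.
Qed.

Section RatioProduct.
Variables (R : realType) (m n q : nat).

Definition ratio_prod (k : nat) : R :=
  \prod_(0 <= j < m) lucas_fib_ratio R (n * k + j * n * q).

Lemma cvg_ratio_prod : (0 < n)%N ->
  ratio_prod k @[k --> \oo] --> (Num.sqrt 5 ^+ m : R).
Proof.
move=> n0.
have -> : Num.sqrt 5 ^+ m = \prod_(0 <= j < m) Num.sqrt 5 :> R.
  by rewrite big_const_nat subn0 -Monoid.iteropE.
apply: (@cvg_big R nat *%R 1); first exact: mul_continuous.
move=> j _; apply: (cvg_comp _ _ (cvgn_affine n (j * n * q) n0)).
exact: cvg_lucas_fib_ratio.
Qed.

Lemma ratio_prodB (k : nat) : (0 < m)%N -> (0 < n)%N -> (0 < k)%N ->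
  ratio_prod k - ratio_prod (k + q) = 2 * (fib (m * n * q))%:R *
    ((-1) ^+ (n * k) *
     ((\prod_(1 <= j < m) (lucas (n * k + j * n * q))%:R) /
      (\prod_(0 <= j < m.+1) (fib (n * k + j * n * q))%:R))).
Proof.
move=> m0 n0 k0.
have f0 j : (fib (n * k + j))%:R != 0 :> R.
  by rewrite pnatr_eq0 -lt0n -[(_ + _)%N]prednK ?fib_gt0// addn_gt0 muln_gt0 n0 k0.
(* Moving [k] by [q] turns the index [j] into [j + 1], since [n(k + q) + jnq = nk + (j + 1)nq]. *)
have shift : ratio_prod (k + q)
    = \prod_(1 <= j < m.+1) lucas_fib_ratio R (n * k + j * n * q).
  rewrite big_add1; apply: eq_bigr => j _; congr lucas_fib_ratio; lia.
(* With the end factors [j = 0] and [j = m] split off, both products share the factors [1 <= j < m],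
   named [L / D] below. *)
rewrite shift /ratio_prod big_nat_recr//= [X in X - _]big_ltn//.
rewrite [X in _ / X]big_ltn// [X in _ / (_ * X)]big_nat_recr//=.
rewrite !mul0n !addn0 /lucas_fib_ratio big_split /= prodfV.
have d0 : \prod_(1 <= j < m) (fib (n * k + j * n * q))%:R != 0 :> R.
  by rewrite prodf_seq_neq0; apply/allP => j _; exact: f0.
have := lucasM_fibD R (n * k) (m * n * q).
have := f0 0%N; rewrite addn0; have := f0 (m * n * q)%N.
move: d0; set D := \prod_(_ <= _ < _) _; set L := \prod_(_ <= _ < _) _.
move=> d0 fb0 fa0 dO; rewrite [X in _ = X](_ : _ =
  2 * (-1) ^+ (n * k) * (fib (m * n * q))%:R * L
    / ((fib (n * k))%:R * (D * (fib (n * k + m * n * q))%:R))); last by ring.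
rewrite -dO; field; rewrite d0 fa0 fb0//.
Qed.

End RatioProduct.

Theorem theorem2p4 (R : realType) (m n q : nat)
    (hm : (0 < m)%N) (hn : (0 < n)%N) (hq : (0 < q)%N) :
  [/\ (\sum_(1 <= k < N.+1)
         (-1) ^+ (n * k - 1)%N *
         ((\prod_(1 <= j < m) (lucas (n * k + j * n * q))%:R) /
          (\prod_(0 <= j < m.+1) (fib (n * k + j * n * q))%:R)) : R)
        @[N --> \oo] -->
      q%:R * Num.sqrt (5 ^+ m) / (2 * (fib (m * n * q))%:R)
      - 1 / (2 * (fib (m * n * q))%:R) *
        \sum_(1 <= k < q.+1) \prod_(0 <= j < m)
          ((lucas (n * k + j * n * q))%:R / (fib (n * k + j * n * q))%:R),
      ~~ odd n ->
      (\sum_(1 <= k < N.+1)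
         (\prod_(1 <= j < m) (lucas (n * k + j * n * q))%:R) /
         (\prod_(0 <= j < m.+1) (fib (n * k + j * n * q))%:R) : R)
        @[N --> \oo] -->
      1 / (2 * (fib (m * n * q))%:R) *
        \sum_(1 <= k < q.+1) \prod_(0 <= j < m)
          ((lucas (n * k + j * n * q))%:R / (fib (n * k + j * n * q))%:R)
      - q%:R * Num.sqrt (5 ^+ m) / (2 * (fib (m * n * q))%:R)
    & odd n ->
      (\sum_(1 <= k < N.+1)
         (-1) ^+ (k - 1)%N *
         ((\prod_(1 <= j < m) (lucas (n * k + j * n * q))%:R) /
          (\prod_(0 <= j < m.+1) (fib (n * k + j * n * q))%:R)) : R)
        @[N --> \oo] -->
      q%:R * Num.sqrt (5 ^+ m) / (2 * (fib (m * n * q))%:R)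
      - 1 / (2 * (fib (m * n * q))%:R) *
        \sum_(1 <= k < q.+1) \prod_(0 <= j < m)
          ((lucas (n * k + j * n * q))%:R / (fib (n * k + j * n * q))%:R)].
Proof.
set t := fun k : nat => (\prod_(1 <= j < m) (lucas (n * k + j * n * q))%:R) /
  (\prod_(0 <= j < m.+1) (fib (n * k + j * n * q))%:R) : R.
set c : R := 2 * (fib (m * n * q))%:R.
set S := \sum_(1 <= k < q.+1) _; set l := q%:R * _.
have c0 : c != 0.
  rewrite mulf_neq0 ?pnatr_eq0// -lt0n -[(m * _ * _)%N]prednK ?fib_gt0//.
  by rewrite !muln_gt0 hm hn hq.
(* The sign [(-1) ^+ (n * k)] is the one [ratio_prodB] produces; all three claims follow from this
   limit by adjusting signs. *)
have main : \sum_(1 <= k < N.+1) (-1) ^+ (n * k) * t k @[N --> \oo]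
    --> 1 / c * S - l / c.
  have -> : 1 / c * S - l / c = c^-1 * (S - l) by ring.
  have E N : \sum_(1 <= k < N.+1) (-1) ^+ (n * k) * t k
      = c^-1 * \sum_(1 <= k < N.+1) (ratio_prod R m n q k - ratio_prod R m n q (k + q)).
    rewrite mulr_sumr; apply: eq_big_nat => k /andP[k0 _].
    by rewrite ratio_prodB// mulKf.
  under eq_cvg do rewrite E.
  apply: cvgMr; rewrite /l sqrtrX//.
  exact/cvg_sum_telescope_step/cvg_ratio_prod.
(* Positivity matters: truncated subtraction gives [0 - 1 = 0]. *)
have sgnB k : (0 < k)%N -> (-1) ^+ (k - 1) = - (-1) ^+ k :> R.
  by case: k => // k _; rewrite subn1 exprS mulN1r opprK.
have signed : \sum_(1 <= k < N.+1) (-1) ^+ (n * k - 1) * t k @[N --> \oo]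
    --> l / c - 1 / c * S.
  have E N : \sum_(1 <= k < N.+1) (-1) ^+ (n * k - 1) * t k
      = - \sum_(1 <= k < N.+1) (-1) ^+ (n * k) * t k.
    rewrite -sumrN; apply: eq_big_nat => k /andP[k0 _].
    by rewrite sgnB ?mulNr// muln_gt0 hn.
  under eq_cvg do rewrite E.
  by rewrite -opprB; exact: cvgN.
split=> // [en|on].
- have E N : \sum_(1 <= k < N.+1) t k = \sum_(1 <= k < N.+1) (-1) ^+ (n * k) * t k.
    by apply: eq_bigr => k _; rewrite -signr_odd oddM (negbTE en) mul1r.
  by under eq_cvg do rewrite E.
(* For odd [n], the numbers [n * k] and [k] have the same parity. *)
- have E N : \sum_(1 <= k < N.+1) (-1) ^+ (k - 1) * t k
      = \sum_(1 <= k < N.+1) (-1) ^+ (n * k - 1) * t k.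
    apply: eq_big_nat => k /andP[k0 _].
    by rewrite !sgnB ?muln_gt0 ?hn// -[in RHS]signr_odd oddM on signr_odd.
  by under eq_cvg do rewrite E.
Qed.
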